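(* Let $G$ be a countable infinite group. Then $G$ does not admit a pair of Hausdorff paratopological group topologies that are transversal and $T_1$-independent if and only if $G$ does not admit a pair of $T_1$-independent Hausdorff paratopological group topologies.
   Context: A paratopological group topology on a group is a topology for which multiplication is jointly continuous. Two non-discrete topologies $\tau_1,\tau_2$ on a set $X$ are transversal if their union generates the discrete topology on $X$. Two $T_1$ topologies $\tau_1,\tau_2$ on $X$ are $T_1$-independent if $\tau_1\cap\tau_2$ is the cofinite topology on $X$. *)

(* Defs.v *)
From mathcomp Require Import all_boot.
From mathcomp Require Import all_classical.
From mathcomp Require Import topology.

Set Implicit Arguments.
Unset Strict Implicit.
Unset Printing Implicit Defensive.

Local Open Scope classical_set_scope.

(* Several topologies live on the same carrier, so a topology on X is an
   explicit inhabitant t of [Topological X]; [topospace t] is X with t. The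
   class t also contains an equality test and a choice operator for X, but
   nothing below depends on how these are chosen. *)
Definition topospace (X : Type) (t : Topological X) : topologicalType :=
  Topological.Pack t.

Definition opens (X : Type) (t : Topological X) : set (set X) :=
  @open (topospace t).

Definition is_discrete (X : Type) (t : Topological X) : Prop :=
  opens t = [set: set X].

(* [sup_topology] has the union of the two systems of open sets as subbase. *)
Definition join_topology (X : choiceType) (t1 t2 : Topological X) :
    Topological X :=
  Topological.class (sup_topology (fun b : bool => if b then t1 else t2)).

Definition transversal_topologies (X : choiceType) (t1 t2 : Topological X) :
    Prop :=
  [/\ ~ is_discrete t1, ~ is_discrete t2 & is_discrete (join_topology t1 t2)].

Definition cofinite_opens (X : Type) : set (set X) :=
  [set A | A = set0 \/ finite_set (~` A)].

Definition T1_independent (X : Type) (t1 t2 : Topological X) : Prop :=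
  [/\ accessible_space (topospace t1), accessible_space (topospace t2)
    & opens t1 `&` opens t2 = @cofinite_opens X].

Definition paratopological (G : groupType) (t : Topological G) : Prop :=
  continuous (fun p : topospace t * topospace t => (p.1 * p.2)%g : topospace t).

Definition hausdorff_paratopological (G : groupType) (t : Topological G) :
    Prop :=
  hausdorff_space (topospace t) /\ paratopological t.

(* Main.v *)
(* No countable infinite set carries two T1-independent Hausdorff topologies, so
   both sides of the equivalence hold; the group structure plays no role. Fix a
   Hausdorff topology on a countable set, and for each pair x <> y an open set
   U x y containing x and disjoint from a neighbourhood of y. A diagonal argument
   applied to the countably many U x y yields, inside any infinite B, an infinite
   C such that each U x y contains almost all or almost no points of C. At most
   one point z has all its neighbourhoods U z y of the first kind, so D together
   with z is closed for every subset D of C. Doing this first for one topology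
   and then for the other gives an infinite proper subset closed in both. *)

Require Import Defs.
From mathcomp Require Import all_boot.
From mathcomp Require Import all_classical.
From mathcomp Require Import topology.

Local Open Scope classical_set_scope.

Lemma infinite_unbounded_inj {T : Type} {f : T -> nat} {A : set T} (n : nat) :
  injective f -> infinite_set A -> exists2 x, A x & (n <= f x)%N.
Proof.
move=> f_inj infA; apply: contrapT => noA; apply: infA.
apply: (@sub_finite_set _ _ (f @^-1` `I_n)) => [x Ax /=|].
  by rewrite ltnNge; apply/negP => nfx; apply: noA; exists x.
by apply: finite_preimage => // x y _ _; apply: f_inj.
Qed.

(** One of [A k] inside [W k] and [A k] outside [W k] is infinite and becomes [A k.+1]. Choosing
    [c n] in [A n] gives a set almost contained in every [A k]. *)
Lemma infinite_almost_homogeneous {T : Type} {B : set T} (W : nat -> set T) :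
  countable [set: T] -> infinite_set B ->
  exists C : set T, [/\ infinite_set C, C `<=` B
    & forall k, finite_set (C `&` W k) \/ finite_set (C `\` W k)].
Proof.
move=> /countable_injP[f f_inj'] infB.
have f_inj : injective f by move=> x y; apply: f_inj'; rewrite inE.
pose step k (A : set T) :=
  if `[< infinite_set (A `&` W k) >] then A `&` W k else A `\` W k.
pose A := fix A n := if n is k.+1 then step k (A k) else B.
have infA n : infinite_set (A n).
  elim: n => //= n IHn; rewrite /step; case: asboolP => // /contrapT finI finD.
  by apply: IHn; rewrite -(setUIDK (A n) (W n)) finite_setU.
have decA m n : (m <= n)%N -> A n `<=` A m.
  elim: n => [|n IHn]; first by rewrite leqn0 => /eqP ->.
  rewrite leq_eqVlt => /predU1P[-> //|mn] x /=.
  by rewrite /step; case: ifP => _ [Ax _]; apply: IHn.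
(* The bound [n <= f x] keeps the range of [c] infinite, although [c] may repeat values. *)
have /choice[c cP] n : exists x, A n x /\ (n <= f x)%N.
  by have [x] := infinite_unbounded_inj n f_inj (infA n); exists x.
have finC k : finite_set (range c `\` A k).
  apply: (@sub_finite_set _ _ (c @` `I_k)); last exact: finite_image.
  move=> _ [[n _ <-] nA]; exists n => //=.
  by rewrite ltnNge; apply/negP => /decA kn; apply: nA; apply/kn/(cP n).1.
exists (range c); split.
- move=> /(finite_image f)/finite_seqP[s sE].
  pose m := \max_(i <- s) i.
  have sm : f (c m.+1) \in s.
    suff : (f @` range c) (f (c m.+1)) by rewrite sE.
    by exists (c m.+1) => //; exists m.+1.
  have fm : (f (c m.+1) <= m)%N by apply: leq_bigmax_seq sm _.
  by have := leq_trans (cP m.+1).2 fm; rewrite ltnn.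
- by move=> _ [n _ <-]; apply: (decA 0 n) => //; case: (cP n).
- move=> k; have [infI|finI] := pselect (infinite_set (A k `&` W k)).
    right; apply: sub_finite_set (finC k.+1) => x [Cx nW]; split=> //=.
    by rewrite /step asboolT // => -[].
  left; apply: sub_finite_set (finC k.+1) => x [Cx Wx]; split=> //=.
  by rewrite /step asboolF // => -[].
Qed.

Lemma hausdorff_infinite_almost_closed {X : topologicalType} {B : set X} :
  hausdorff_space X -> countable [set: X] -> infinite_set B ->
  exists C z, [/\ infinite_set C, C `<=` B
    & forall D, D `<=` C -> closed (D `|` [set z])].
Proof.
move=> hX cX infB; have /countable_injP[f f_inj'] := cX.
have f_inj : injective f by move=> x y; apply: f_inj'; rewrite inE.
have sep (p : X * X) : exists U : set X, p.1 != p.2 ->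
    [/\ open U, U p.1 & exists V, [/\ open V, V p.2 & U `&` V = set0]].
  have [->|/= pneq] := eqVneq p.1 p.2; first by exists set0.
  move: hX; rewrite open_hausdorff => /(_ _ _ pneq)[[U V] /= []].
  rewrite !inE => Ux Vy [oU oV UV0].
  by exists U => _; split=> //; exists V; split=> //; apply/eqP.
have [U UP] := choice sep.
(* Listing the sets [U (x, y)] by natural numbers; [W n] is empty when [n] codes no pair. *)
pose W n := [set w | exists x y, n = pickle (f x, f y) /\ U (x, y) w].
have WE x y : W (pickle (f x, f y)) = U (x, y).
  apply/seteqP; split=> [w [x' [y' []]]|w Uw]; last by exists x, y.
  by move/(pcan_inj pickleK) => -[/f_inj -> /f_inj ->].
have [C [infC CB CW]] := infinite_almost_homogeneous W cX infB.
pose sparse y := exists V, [/\ open V, V y & finite_set (C `&` V)].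
(* If every [U (z, y)] meets [C] infinitely often, it contains almost all of [C], so the disjoint
   neighbourhood of [y] witnesses [sparse y]. If no such [z] exists, all points are sparse and [z]
   is arbitrary. *)
have [z zP] : exists z, forall y, y != z -> sparse y.
  have [[z zW]|noz] := pselect (exists z, forall y, y != z ->
      infinite_set (C `&` U (z, y))).
    exists z => y yz; have := UP (z, y).
    rewrite eq_sym in yz => /(_ yz)[oU Uz [V [oV Vy UV0]]].
    exists V; split=> //; have := CW (pickle (f z, f y)); rewrite WE.
    rewrite eq_sym in yz; case=> [/zW/(_)|]; first exact.
    apply: sub_finite_set => x [Cx Vx]; split=> // Ux.
    by have : (U (z, y) `&` V) x by []; rewrite UV0.
  have [z _] := infinite_setN0 infB.
  exists z => x _; apply: contrapT => xsp; apply: noz; exists x => y yx finU.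
  rewrite eq_sym in yx; have [oU Ux _] := UP (x, y) yx.
  by apply: xsp; exists (U (x, y)).
exists C, z; split=> // D DC y Dy.
have [->|yz] := eqVneq y z; first by right.
have [V [oV Vy finV]] := zP _ yz.
(* Removing the finite closed set [F] from [V] leaves a neighbourhood of [y] that can meet the set
   only in [y] itself. *)
pose F := ((C `&` V) `|` [set z]) `\` [set y].
have clF : closed F.
  apply: (accessible_finite_set_closed.1 (hausdorff_accessible hX)).
  by apply: finite_setD; rewrite finite_setU; split.
have /Dy[x [Dx [Vx nFx]]] : nbhs y (V `&` ~` F).
  apply: open_nbhs_nbhs; split; first by apply: openI => //; exact: closed_openC.
  by split=> // -[_]; apply.
have [<- //|xy] := pselect (x = y).
exfalso; apply: nFx; split=> //.
by case: Dx => [/DC Cx|]; [left|right].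
Qed.

Lemma countable_hausdorff_not_T1_independent {X : Type} (t1 t2 : Topological X) :
  countable [set: X] -> infinite_set [set: X] ->
  hausdorff_space (topospace t1) -> hausdorff_space (topospace t2) ->
  ~ T1_independent t1 t2.
Proof.
move=> cX infX h1 h2 [a1 a2 tE].
have [C [z1 [infC _ C1]]] :=
  @hausdorff_infinite_almost_closed (topospace t1) _ h1 cX infX.
have [D [z2 [infD DC D2]]] :=
  @hausdorff_infinite_almost_closed (topospace t2) _ h2 cX infC.
(* The union is closed in both topologies, so its complement is open in both; being infinite, it
   must be the whole space. *)
have full E : E `<=` D -> infinite_set E -> E `|` [set z1; z2] = setT.
  move=> ED infE; set A := E `|` _.
  have A1 : @closed (topospace t1) A.
    rewrite /A setUA; apply: closedU; first by apply: C1 => x /ED/DC.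
    exact: accessible_closed_set1.
  have A2 : @closed (topospace t2) A.
    rewrite /A (setUC [set z1]) setUA; apply: closedU; first exact: D2.
    exact: accessible_closed_set1.
  have : (opens t1 `&` opens t2) (~` A).
    by split; rewrite /opens; exact: closed_openC.
  rewrite tE => -[/(congr1 setC)|]; rewrite setCK; first by rewrite setC0.
  by rewrite finite_setU => -[/infE].
have [d [Dd dz]] : exists d, D d /\ ~ [set z1; z2] d.
  have fz : finite_set [set z1; z2] by rewrite finite_setU; split.
  by have [d []] := infinite_setN0 (infinite_setD infD fz); exists d.
have : ((D `\ d) `|` [set z1; z2]) d.
  by rewrite full //; exact: infinite_setD.
by case=> [[_ nd]|//]; apply: nd.
Qed.

Theorem theorem3p6 (G : groupType)
    (countableG : countable [set: G]) (infiniteG : infinite_set [set: G]) :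
  ~ (exists t1 t2 : Topological G,
       [/\ hausdorff_paratopological t1, hausdorff_paratopological t2,
           transversal_topologies t1 t2 & T1_independent t1 t2])
  <->
  ~ (exists t1 t2 : Topological G,
       [/\ hausdorff_paratopological t1, hausdorff_paratopological t2
         & T1_independent t1 t2]).
Proof.
split=> _ [t1 [t2]].
  case=> -[h1 _] [h2 _].
  exact: countable_hausdorff_not_T1_independent.
case=> -[h1 _] [h2 _] _.
exact: countable_hausdorff_not_T1_independent.
Qed.
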